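(* $\mathrm{ex}(n,\{\text{taco},\text{david},\text{crossing},\text{bat},\text{ears}\})\in\Theta(n^2)$.
   Context: Let $P$ be a set of $n$ points in convex position in the plane (the vertices of a convex $n$-gon); a triangle on $P$ is a 3-element subset of $P$. For two distinct triangles $t_1,t_2$ on $P$, label each point of $t_1\cup t_2$ by the triangle(s) containing it and read the points in their cyclic order around the polygon. The pair forms exactly one of eight configurations. (i) If $t_1,t_2$ share two vertices $u,v$: ''taco'' if their third vertices lie on the same side of the line $uv$, ''mariposa'' if on opposite sides. (ii) If they share exactly one vertex $v$: read the remaining four vertices in cyclic order starting just after $v$; ''bat'' if the pattern is $t_1t_1t_2t_2$ or $t_2t_2t_1t_1$, ''nested'' if it is $t_1t_2t_2t_1$ or $t_2t_1t_1t_2$, ''crossing'' if it is $t_1t_2t_1t_2$ or $t_2t_1t_2t_1$. (iii) If they share no vertex, the cyclic sequence of the six labels is, up to rotation, reflection and exchanging the roles of $t_1,t_2$, one of: ''ears'' $AAABBB$, ''swords'' $AABABB$, ''david'' $ABABAB$. For a set $X$ of configurations, $\mathrm{ex}(n,X)$ is the maximum size of a family of triangles on $P$ in which no two triangles form a configuration belonging to $X$ (this depends only on $n$ and $X$). *)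

(* Defs.v *)
From HB Require Import structures.
From mathcomp Require Export all_boot all_order all_algebra.
From mathcomp Require Export finmap reals.

Set Implicit Arguments.
Unset Strict Implicit.
Unset Printing Implicit Defensive.

Import Order.TTheory GRing.Theory Num.Theory.
Local Open Scope ring_scope.

Section Plane.
Variable R : realType.
Implicit Types a b c : 'rV[R]_2.

(* Twice the signed area of the triangle a b c: positive iff a, b, c make a
   counterclockwise turn; its sign tells on which side of line a b lies c. *)
Definition orient a b c : R :=
  (b 0 0 - a 0 0) * (c 0 1 - a 0 1) - (b 0 1 - a 0 1) * (c 0 0 - a 0 0).

(* No point of P lies in the convex hull of the other points of P. *)
Definition convex_position (P : {fset 'rV[R]_2}) : Prop :=
  forall x : P, ~ exists w : P -> R,
    [/\ forall y, 0 <= w y, w x = 0, \sum_y w y = 1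
      & \sum_y w y *: val y = val x].

End Plane.

Inductive configuration :=
  Taco | Mariposa | Bat | Nested | Crossing | Ears | Swords | David.

Section Configurations.
Variables (R : realType) (P : {fset 'rV[R]_2}).
Implicit Types (s : seq P) (t : {set P}).

(* The sequence s lists vertices of the convex polygon P in their
   counterclockwise cyclic order: every three entries, taken in the order in
   which they appear in s, make a counterclockwise turn. *)
Fixpoint ccw s : bool :=
  if s is x :: s' then
    pairwise (fun y z : P => 0 < orient (val x) (val y) (val z)) s' && ccw s'
  else true.

(* The word of labels read along s; true stands for t1, false for t2. It is
   only used on points belonging to exactly one of the two triangles. *)
Definition labels t1 s : seq bool := [seq x \in t1 | x <- s].

(* t1 = {u, v, x} and t2 = {u, v, y}, where the product of orientations is
   positive iff x and y are strictly on the same side of line u v, negative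
   iff they are strictly on opposite sides. *)
Definition share_edge (side : R -> bool) t1 t2 : bool :=
  [exists u : P, exists v : P, exists x : P, exists y : P,
    [&& u != v, t1 :&: t2 == [set u; v], t1 :\: t2 == [set x],
        t2 :\: t1 == [set y] &
        side (orient (val u) (val v) (val x) * orient (val u) (val v) (val y))]].

(* The four vertices other than the common one, v, are read in cyclic order
   starting just after v. The sets of words used below are closed under
   reversal, so that the sense of rotation is immaterial. *)
Definition share_vertex (words : seq (seq bool)) t1 t2 : bool :=
  [exists v : P, exists s : 4.-tuple P,
    [&& t1 :&: t2 == [set v],
        [set x in s] == (t1 :|: t2) :\ v,
        ccw (v :: s) & labels t1 s \in words]].

(* w is w0 up to rotation, reflection and exchange of the two labels. *)
Definition same_word (w0 w : seq bool) : bool :=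
  [exists k : 'I_(size w0),
    w \in [:: rot k w0; rot k (rev w0);
              rot k (map negb w0); rot k (rev (map negb w0))]].

Definition share_none (w0 : seq bool) t1 t2 : bool :=
  [exists s : 6.-tuple P,
    [&& t1 :&: t2 == set0, [set x in s] == t1 :|: t2,
        ccw s & same_word w0 (labels t1 s)]].

Let A := true.
Let B := false.

Definition forms (c : configuration) t1 t2 : bool :=
  match c with
  | Taco => share_edge (fun r => 0 < r) t1 t2
  | Mariposa => share_edge (fun r => r < 0) t1 t2
  | Bat => share_vertex [:: [:: A; A; B; B]; [:: B; B; A; A]] t1 t2
  | Nested => share_vertex [:: [:: A; B; B; A]; [:: B; A; A; B]] t1 t2
  | Crossing => share_vertex [:: [:: A; B; A; B]; [:: B; A; B; A]] t1 t2
  | Ears => share_none [:: A; A; A; B; B; B] t1 t2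
  | Swords => share_none [:: A; A; B; A; B; B] t1 t2
  | David => share_none [:: A; B; A; B; A; B] t1 t2
  end.

Definition triangle t : bool := #|t| == 3.

Definition avoids (X : seq configuration) (F : {set {set P}}) : bool :=
  [forall t1 in F, forall t2 in F,
    (t1 != t2) ==> all (fun c => ~~ forms c t1 t2) X].

Definition ex_size (X : seq configuration) : nat :=
  (\max_(F : {set {set P}} | [forall t in F, triangle t] && avoids X F) #|F|)%N.

End Configurations.

(* Main.v *)
(* Upper bound: a triangle is determined by any of its edges, directed
   counterclockwise, since two triangles on the same side of an edge form a taco.

   Lower bound: number the points counterclockwise and split them into three
   consecutive arcs. Take triangles with one vertex in each arc whose positions
   have a prescribed sum. Comparing two of them arc by arc, the position
   differences have zero sum, so they are not all of the same sign (no david),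
   at most one of them vanishes (no taco), and if one vanishes the other two have
   opposite signs (no crossing). Bats and ears are excluded by the arcs alone. *)
Require Import Defs.
From mathcomp Require Import zify ring lra.

Set Implicit Arguments.
Unset Strict Implicit.
Unset Printing Implicit Defensive.

Import Order.TTheory GRing.Theory Num.Theory.

(** * Arithmetic of vertex positions around the polygon *)

Definition cyclic_lt (i j k : nat) :=
  [|| i < j < k, j < k < i | k < i < j].

Definition mem3 (a b c x : nat) := [|| x == a, x == b | x == c].

(** One vertex per arc. The last arc has no upper bound because the third position, fixed by the
    sum, needs a range about twice as long as the others. *)
Definition spread (K a b c : nat) := [&& a < K, K <= b < 2 * K & 2 * K <= c].

Section Spread.
Variables (K a b c a' b' c' : nat).

(** The arcs are disjoint, so a common position fills the same slot in both triples. Two common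
    slots and equal sums force the third. *)
Lemma spread_common2 u v : spread K a b c -> spread K a' b' c' ->
  a + b + c = a' + b' + c' -> u != v -> mem3 a b c u -> mem3 a' b' c' u ->
  mem3 a b c v -> mem3 a' b' c' v -> [/\ a = a', b = b' & c = c'].
Proof.
rewrite /spread /mem3 => sp sp' eq_sum uv ut ut' vt vt'.
have : [&& a == a', b == b' & c == c'] by lia.
by move=> /and3P[/eqP -> /eqP -> /eqP ->].
Qed.

(** Going round from [v], [x2] lies in the last of the two remaining arcs, so [x3] and [x4] would
    both lie there, while a triple has one point per arc. *)
Lemma spread_not_bat v x1 x2 x3 x4 : spread K a b c -> spread K a' b' c' ->
  mem3 a b c v -> mem3 a' b' c' v ->
  mem3 a b c x1 -> mem3 a b c x2 -> mem3 a' b' c' x3 -> mem3 a' b' c' x4 ->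
  ~~ [&& cyclic_lt v x1 x2, cyclic_lt v x2 x3 & cyclic_lt v x3 x4].
Proof.
rewrite /spread /mem3 /cyclic_lt => sp sp'.
by move=> /or3P[] /eqP-> /or3P[] /eqP e; try lia;
  move=> /or3P[] /eqP-> /or3P[] /eqP->; lia.
Qed.

(** [x1] and [x2] share the arc following that of [v], and [x3] and [x4] share the last one. The
    second triple is ahead in both, against equal sums. *)
Lemma spread_not_crossing v x1 x2 x3 x4 :
  spread K a b c -> spread K a' b' c' -> a + b + c = a' + b' + c' ->
  mem3 a b c v -> mem3 a' b' c' v ->
  mem3 a b c x1 -> mem3 a' b' c' x2 -> mem3 a b c x3 -> mem3 a' b' c' x4 ->
  ~~ [&& cyclic_lt v x1 x2, cyclic_lt v x2 x3 & cyclic_lt v x3 x4].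
Proof.
rewrite /spread /mem3 /cyclic_lt => sp sp' eq_sum.
by move=> /or3P[] /eqP-> /or3P[] /eqP e; try lia;
  move=> /or3P[] /eqP-> + /or3P[] /eqP->; lia.
Qed.

(** Every [w] would lie in the gap from [z] to [x]. That gap misses the arc of [y], where the second
    triple also has a point. *)
Lemma spread_not_ears x y z : spread K a b c -> spread K a' b' c' ->
  mem3 a b c x -> mem3 a b c y -> mem3 a b c z -> cyclic_lt x y z ->
  ~~ all (fun w => cyclic_lt x y w && cyclic_lt y z w) [:: a'; b'; c'].
Proof.
rewrite /spread /mem3 /cyclic_lt /= => sp sp'.
by move=> /or3P[] /eqP-> /or3P[] /eqP-> /or3P[] /eqP->; lia.
Qed.

(** As each arc holds one [y], the arc chosen by [y1], that of [x1] or of [x2], settles the others: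
    either every [y] is ahead of the [x] of its arc or every [y] is behind it. Equal sums exclude
    both. *)
Lemma spread_not_david x1 x2 x3 y1 y2 y3 :
  spread K a b c -> spread K a' b' c' -> a + b + c = a' + b' + c' ->
  mem3 a b c x1 -> mem3 a b c x2 -> mem3 a b c x3 ->
  mem3 a' b' c' y1 -> mem3 a' b' c' y2 -> mem3 a' b' c' y3 ->
  cyclic_lt x1 x2 x3 -> cyclic_lt y1 y2 y3 ->
  ~~ [&& cyclic_lt x1 y1 x2, cyclic_lt x2 y2 x3 & cyclic_lt x3 y3 x1].
Proof.
rewrite /spread /mem3 /cyclic_lt => sp sp' eq_sum.
move=> /or3P[] /eqP-> /or3P[] /eqP-> /or3P[] /eqP-> h1 h2 h3 h4; try lia;
  by move: h1 h2 h3 => /or3P[] /eqP-> /or3P[] /eqP-> /or3P[] /eqP->; lia.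
Qed.

End Spread.

Local Open Scope ring_scope.

(** * Algebraic identities for [orient] *)

Section Orientation.
Variable R : realType.
Implicit Types a b c d : 'rV[R]_2.

Lemma rV2_eq a b : a 0 0 = b 0 0 -> a 0 1 = b 0 1 -> a = b.
Proof.
move=> e0 e1; apply/rowP => -[[|[|//]] lt_i2].
  by rewrite (_ : Ordinal _ = 0) //; apply: val_inj.
by rewrite (_ : Ordinal _ = 1) //; apply: val_inj.
Qed.

Lemma orient_rot a b c : orient b c a = orient a b c.
Proof. by rewrite /orient; ring. Qed.

Lemma orient_swap a b c : orient b a c = - orient a b c.
Proof. by rewrite /orient; ring. Qed.

Lemma orient_swapr a b c : orient a c b = - orient a b c.
Proof. by rewrite /orient; ring. Qed.

Lemma orient_xx a b : orient a a b = 0.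
Proof. by rewrite /orient; ring. Qed.

(** The numerators of the barycentric coordinates of [d] in the triangle [a b c] add up to their
    common denominator. *)
Lemma orient_split d a b c :
  orient d b c + orient a d c + orient a b d = orient a b c.
Proof. by rewrite /orient; ring. Qed.

End Orientation.

(** * Points in convex position and their counterclockwise numbering *)

Section ConvexPosition.
Variables (R : realType) (P : {fset 'rV[R]_2}).
Hypothesis convP : convex_position P.
Implicit Types x y z a b c d v : P.

Local Notation area x y z := (orient (val x) (val y) (val z)).

(** The points [a], [b], [c] may coincide: repeating one of them with weight 0 gives the case of a
    segment. *)
Lemma not_convex_combination x a b c (wa wb wc : R) :
  x != a -> x != b -> x != c -> 0 <= wa -> 0 <= wb -> 0 <= wc ->
  wa + wb + wc = 1 -> wa *: val a + wb *: val b + wc *: val c <> val x.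
Proof.
move=> xa xb xc wa0 wb0 wc0 w1 wx; apply: (convP (x := x)).
have sum_delta (d : P) (w : R) : \sum_y (y == d)%:R * w = w.
  rewrite (bigD1 d) //= eqxx mul1r big1 ?addr0 // => y /negPf ->.
  by rewrite mul0r.
have sum1 (V : lmodType R) (d : P) (w : R) (f : P -> V) :
    \sum_y ((y == d)%:R * w) *: f y = w *: f d.
  rewrite (bigD1 d) //= eqxx mul1r big1 ?addr0 // => y /negPf ->.
  by rewrite mul0r scale0r.
exists (fun y => (y == a)%:R * wa + (y == b)%:R * wb + (y == c)%:R * wc).
split=> [y||| ].
- by rewrite !addr_ge0 // mulr_ge0 // ler0n.
- by rewrite (negPf xa) (negPf xb) (negPf xc) !mul0r !addr0.
- by rewrite !big_split /= !sum_delta.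
- under eq_bigr do rewrite !scalerDl.
  by rewrite !big_split /= !sum1.
Qed.

(** Otherwise the three area ratios would be barycentric coordinates expressing [x] through [a],
    [b], [c]. *)
Lemma not_in_triangle x a b c :
  x != a -> x != b -> x != c ->
  0 <= area x b c -> 0 <= area a x c -> 0 <= area a b x -> ~~ (0 < area a b c).
Proof.
move=> xa xb xc ha hb hc; apply/negP => habc.
have nz : area a b c != 0 by rewrite gt_eqF.
apply: (@not_convex_combination x a b c (area x b c / area a b c)
  (area a x c / area a b c) (area a b x / area a b c)) => //;
  try by rewrite divr_ge0 // ltW.
  by rewrite -!mulrDl orient_split divff.
by move: nz; rewrite /orient => nz; apply: rV2_eq; rewrite !mxE; field.
Qed.

(** Of three distinct collinear points, one lies between the other two and is a convex combination
    of them. *)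
Lemma area_neq0 a b c : a != b -> a != c -> b != c -> area a b c != 0.
Proof.
move=> ab ac bc; apply/eqP => e0.
have [l el] : exists l : R, val c = (1 - l) *: val a + l *: val b.
  (* The parameter [l] is read off a coordinate in which [a] and [b] differ. *)
  have [e|ne] := eqVneq (val b 0 0) (val a 0 0).
    have nz : val b 0 1 - val a 0 1 != 0.
      by rewrite subr_eq0; apply: contraNneq ab => e1; apply/eqP/val_inj/rV2_eq.
    exists ((val c 0 1 - val a 0 1) / (val b 0 1 - val a 0 1)).
    apply: rV2_eq; rewrite !mxE; last by field.
    apply/eqP; rewrite -subr_eq0; apply/eqP.
    transitivity (- area a b c / (val b 0 1 - val a 0 1)).
      by rewrite /orient; field.
    by rewrite e0 oppr0 mul0r.
  exists ((val c 0 0 - val a 0 0) / (val b 0 0 - val a 0 0)).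
  have nz : val b 0 0 - val a 0 0 != 0 by rewrite subr_eq0.
  apply: rV2_eq; rewrite !mxE; first by field.
  apply/eqP; rewrite -subr_eq0; apply/eqP.
  transitivity (area a b c / (val b 0 0 - val a 0 0)).
    by rewrite /orient; field.
  by rewrite e0 mul0r.
(* The middle point is [a] if [l < 0], [c] if [l] is in the unit interval, and [b] if [l > 1]. *)
have [l0|l0] := ltP l 0.
  apply: (@not_convex_combination a c b b (1 - l)^-1 (- l / (1 - l)) 0) => //.
  - by rewrite invr_ge0; lra.
  - by rewrite divr_ge0; lra.
  - by field; lra.
  - by rewrite el; apply: rV2_eq; rewrite !mxE; field; lra.
have [l1|l1] := leP l 1.
  apply: (@not_convex_combination c a b b (1 - l) l 0) => //.
  - by rewrite eq_sym.
  - by rewrite eq_sym.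
  - by rewrite eq_sym.
  - by lra.
  - by ring.
  - by rewrite el scale0r addr0.
apply: (@not_convex_combination b a c c (1 - l^-1) l^-1 0) => //.
- by rewrite eq_sym.
- by rewrite subr_ge0 invf_le1; lra.
- by rewrite invr_ge0; lra.
- by ring.
- by rewrite el; apply: rV2_eq; rewrite !mxE; field; lra.
Qed.

Lemma area_gt0_neq a b c : 0 < area a b c -> [/\ a != b, b != c & a != c].
Proof.
move=> h; split; apply: contraTneq h => ->; rewrite ?orient_xx ?ltxx //.
  by rewrite -orient_rot orient_xx ltxx.
by rewrite orient_rot orient_xx ltxx.
Qed.

(* Otherwise [v] would lie in the triangle [x y z]. *)
Lemma area_trans v x y z : 0 < area v x y -> 0 < area v y z -> x != z ->
  0 < area v x z.
Proof.
move=> h1 h2 xz; have [vx xy vy] := area_gt0_neq h1.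
have [_ yz vz] := area_gt0_neq h2.
rewrite ltNge le_eqVlt negb_or area_neq0 //=; apply/negP => h3.
have h4 : 0 <= area x v z by rewrite orient_swap; lra.
have h5 : 0 <= area x y v by rewrite orient_rot ltW.
have /negP[] := not_in_triangle vx vy vz (ltW h2) h4 h5.
by rewrite -(orient_split (val v)); lra.
Qed.

(* Otherwise [y] would lie in the triangle [v x z]. *)
Lemma area_shift v x y z : 0 < area v x y -> 0 < area v y z -> x != z ->
  0 < area x y z.
Proof.
move=> h1 h2 xz; have [vx xy vy] := area_gt0_neq h1.
have [_ yz vz] := area_gt0_neq h2.
have h := area_trans h1 h2 xz.
rewrite ltNge le_eqVlt negb_or area_neq0 //=; apply/negP => h3.
have h4 : 0 <= area y x z by rewrite orient_swap; lra.
have := not_in_triangle _ _ yz h4 (ltW h2) (ltW h1).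
by rewrite h !(eq_sym y) vy xy => /(_ isT isT).
Qed.

(** Sort the points by angle around one of them, [v], taken as least element. [area_neq0] makes this
    order total, [area_trans] makes it transitive, and [area_shift] carries turns seen from [v] over
    to arbitrary triples. *)
Lemma ccw_enumeration : exists pos : P -> nat,
  [/\ injective pos, forall i, (i < #|{: P}|)%N -> exists x, pos x = i
    & forall x y z, (0 < area x y z) = cyclic_lt (pos x) (pos y) (pos z)].
Proof.
have [v _|P0] := pickP (@predT P); last first.
  exists (fun=> 0); split=> [x|i|x]; try by have := P0 x.
  by rewrite eq_card0.
pose le y z := [|| y == v, y == z | 0 < area v y z].
have le_total : total le.
  move=> y z; rewrite /le; have [//|vy] := eqVneq y v.
  have [//|yz] := eqVneq y z.
  have [|vz] := eqVneq z v; first by rewrite orbT.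
  have := @area_neq0 v y z; rewrite !(eq_sym v) vy vz yz => /(_ isT isT isT).
  rewrite [area v z y]orient_swapr oppr_gt0.
  by rewrite neq_lt orbC.
have le_trans : transitive le.
  move=> y x z; rewrite /le => /or3P[/eqP->|/eqP->|h1]; rewrite ?eqxx //.
  move=> /or3P[/eqP yv|/eqP<-|h2].
    by case/area_gt0_neq: h1; rewrite yv eqxx.
    by rewrite h1 !orbT.
  have [//|xz] /= := eqVneq x z; first by rewrite orbT.
  by rewrite (area_trans h1 h2 xz) orbT.
pose s := sort le (enum {: P}).
have ins x : x \in s by rewrite mem_sort mem_enum.
have idx_inj x y : (index x s == index y s) = (x == y).
  apply/eqP/eqP => [e|-> //]; by rewrite -(nth_index v (ins x)) e nth_index.
have lt_le x y : (index x s < index y s)%N -> [/\ x != y & le x y].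
  move=> h; split; first by rewrite -idx_inj ltn_eqF.
  by apply: (sorted_ltn_index le_trans (sort_sorted le_total (enum {: P}))).
have main x y z : (index x s < index y s < index z s)%N -> 0 < area x y z.
  move=> /andP[hxy hyz]; have [xy lxy] := lt_le _ _ hxy.
  have [yz lyz] := lt_le _ _ hyz.
  have [xz lxz] := lt_le _ _ (ltn_trans hxy hyz).
  have lev a : le a v -> a = v.
    by case/or3P=> [/eqP//|/eqP//|/area_gt0_neq[_ _]]; rewrite eqxx.
  have nv a b : le a b -> a != b -> b != v.
    by move=> l; apply: contraNneq => e; rewrite e in l *; apply/eqP/lev.
  have yv := nv _ _ lxy xy.
  have ayz : 0 < area v y z by move: lyz; rewrite /le (negPf yv) (negPf yz).
  have [-> //|xv] := eqVneq x v.
  have axy : 0 < area v x y by move: lxy; rewrite /le (negPf xv) (negPf xy).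
  exact: area_shift axy ayz xz.
have size_s : size s = #|{: P}| by rewrite size_sort cardE.
exists (index^~ s); split=> [x y /eqP|i lt_i|x y z].
- by rewrite idx_inj => /eqP.
- by exists (nth v s i); rewrite index_uniq ?size_s ?sort_uniq ?enum_uniq.
apply/idP/idP => [h|/or3P[/main//|/main|/main]]; last 2 first.
- by rewrite orient_rot.
- by rewrite -orient_rot.
have [xy yz xz] := area_gt0_neq h.
(* Three distinct indices not in cyclic order become so once [x] and [y] are exchanged, and [main]
   then gives the opposite orientation. *)
apply: contraTT h => nc; rewrite -leNgt -oppr_ge0 -orient_swap ltW //.
have : cyclic_lt (index y s) (index x s) (index z s).
  move: xy yz xz nc; rewrite /cyclic_lt -!idx_inj; lia.
case/or3P=> /main //; last by rewrite -orient_rot.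
by rewrite orient_rot.
Qed.

End ConvexPosition.

(** * Upper bound: taco-free families inject into directed edges *)

Section UpperBound.
Variables (R : realType) (P : {fset 'rV[R]_2}).
Hypothesis convP : convex_position P.
Local Notation area x y z := (orient (val x) (val y) (val z)).

Lemma triangle_ccw (t : {set P}) : triangle t ->
  exists u v w : P, t = [set u; v; w] /\ 0 < area u v w.
Proof.
rewrite /triangle => t3.
have /card_gt0P[u ut] : (0 < #|t|)%N by rewrite (eqP t3).
have /cards2P[v [w [vw tu]]] : #|t :\ u| == 2.
  by move: t3; rewrite (cardsD1 u) ut.
have uv : u != v by apply/eqP => e; move: (set21 v w); rewrite -tu e !inE eqxx.
have uw : u != w by apply/eqP => e; move: (set22 v w); rewrite -tu e !inE eqxx.
have te : t = [set u; v; w] by rewrite -(setD1K ut) tu setUA.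
have := area_neq0 convP uv uw vw; rewrite neq_lt.
move=> /orP[h|h]; last by exists u, v, w.
exists u, w, v; split; last by rewrite orient_swapr oppr_gt0.
by rewrite te -!setUA [X in _ :|: X]setUC.
Qed.

Lemma taco_free_card (F : {set {set P}}) :
  {in F, forall t, triangle t} ->
  {in F &, forall t1 t2, t1 != t2 -> ~~ forms Taco t1 t2} ->
  (#|F| <= #|{: P}| ^ 2)%N.
Proof.
move=> tri noT; have [->|[t0 t0F]] := set_0Vmem F; first by rewrite cards0.
have [u0 [v0 _]] := triangle_ccw (tri _ t0F).
pose edge (t : {set P}) (e : P * P) :=
  [exists w, (t == [set e.1; e.2; w]) && (0 < area e.1 e.2 w)].
(* The default pair only makes [f] total; by [fP] every triangle of [F] gets a genuine edge. *)
pose f t := odflt (u0, v0) [pick e | edge t e].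
have fP t : t \in F -> edge t (f t).
  move=> tF; rewrite /f; case: pickP => //= none.
  have [u [v [w [te h]]]] := triangle_ccw (tri _ tF).
  by have /existsP[] := none (u, v); exists w; rewrite te eqxx.
rewrite -mulnn -card_prod; apply: (@leq_card_in _ _ f) => t1 t2 t1F t2F ef.
apply/eqP; apply: contraT => ne; case/negP: (noT _ _ t1F t2F ne).
have /existsP[x /andP[/eqP e1 h1]] := fP _ t1F.
have /existsP[y /andP[/eqP e2 h2]] := fP _ t2F.
move: h1 h2 e1 e2; rewrite -ef; case: (f t1) => u v /= h1 h2 e1 e2.
(* Both third vertices lie to the left of the common edge [u v]; being distinct, they form a
   taco. *)
have xy : x != y by apply: contraNneq ne => xy; rewrite e1 e2 xy.
have [uv vx ux] := area_gt0_neq h1; have [_ vy uy] := area_gt0_neq h2.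
apply/existsP; exists u; apply/existsP; exists v.
apply/existsP; exists x; apply/existsP; exists y.
rewrite mulr_gt0 // uv andbT /= e1 e2; apply/and3P; split; apply/eqP/setP => z;
  rewrite !inE;
  (case: (eqVneq z u) => [->|zu]; last case: (eqVneq z v) => [->|zv]);
  rewrite ?eqxx ?(negPf uv) ?(negPf ux) ?(negPf vx) ?(negPf uy) ?(negPf vy) //=.
- by have [->|] := eqVneq z x; rewrite ?(negPf xy).
- by have [->|] := eqVneq z x; rewrite ?(negPf xy) ?andbF.
- by have [->|] := eqVneq z y; rewrite ?andbF // eq_sym (negPf xy).
Qed.

End UpperBound.

(** * Rotating counterclockwise lists and label words *)

Section CyclicWords.
Variables (R : realType) (P : {fset 'rV[R]_2}).
Implicit Types s : seq P.

Lemma ccw_rcons s x : ccw (rcons s x) = ccw (x :: s).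
Proof.
elim: s => //= y s ->; rewrite pairwise_rcons /=.
under [in X in X && _]eq_all do rewrite orient_rot.
by rewrite andbACA.
Qed.

Lemma ccw_catC s1 s2 : ccw (s1 ++ s2) = ccw (s2 ++ s1).
Proof.
elim: s1 s2 => [|x s1 IH] s2; first by rewrite cats0.
by rewrite -cat_rcons -IH -rcons_cat ccw_rcons.
Qed.

Lemma ccw_rot k s : ccw (rot k s) = ccw s.
Proof. by rewrite /rot ccw_catC cat_take_drop. Qed.

(* The ears and david words are rotations of their reversals and of their
   complements, so that [same_word] reduces to rotation for them. *)
Lemma same_word_rot (w0 w : seq bool) :
  w0 \in [:: [:: true; true; true; false; false; false];
            [:: true; false; true; false; true; false]] ->
  same_word w0 w -> exists k, rot k w = w0.
Proof.
move=> w0P sw; suff : has (fun k => rot k w == w0) (iota 0 6).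
  by move=> /hasP[k _ /eqP]; exists k.
move: w0P sw; rewrite !inE => /orP[] /eqP-> /existsP[[k lt_k]];
  by move: k lt_k => [|[|[|[|[|[|//]]]]]] ?; rewrite !inE => /or4P[] /eqP->.
Qed.

(** Rotation preserves [ccw], so the six points can be listed with labels reading exactly [w0]. The
    last two clauses are there because labels record membership in [t1] only. *)
Lemma share_none_rot w0 (t1 t2 : {set P}) :
  w0 \in [:: [:: true; true; true; false; false; false];
            [:: true; false; true; false; true; false]] ->
  share_none w0 t1 t2 -> exists s,
    [/\ ccw s, labels t1 s = w0 & {in s, forall x, x \notin t1 -> x \in t2}
      /\ {in t2, forall x, x \in s /\ x \notin t1}].
Proof.
move=> w0P /existsP[s /and4P[/eqP t12 /eqP es ccws /(same_word_rot w0P)[k ek]]].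
exists (rot k s); rewrite ccw_rot /labels map_rot; split=> //.
have ms x : (x \in rot k s) = (x \in t1 :|: t2) by rewrite mem_rot -es inE.
split=> x; first by rewrite ms !inE => /orP[->|].
move=> xt2; rewrite ms inE xt2 orbT; split=> //.
by apply/negP => xt1; have := in_set0 x; rewrite -t12 inE xt1 xt2.
Qed.

End CyclicWords.

(** * Lower bound: forbidden configurations translated into positions *)

Section LowerBound.
Variables (R : realType) (P : {fset 'rV[R]_2}).
Local Notation area x y z := (orient (val x) (val y) (val z)).
Variable pos : P -> nat.
Hypothesis pos_inj : injective pos.
Hypothesis areaE : forall x y z : P,
  (0 < area x y z) = cyclic_lt (pos x) (pos y) (pos z).

Lemma mem3_pos a b c x :
  (x \in [set a; b; c]) = mem3 (pos a) (pos b) (pos c) (pos x).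
Proof. by rewrite !inE /mem3 !(inj_eq pos_inj) orbA. Qed.

Variable K : nat.
Variables a b c a' b' c' : P.
Hypothesis spt : spread K (pos a) (pos b) (pos c).
Hypothesis spt' : spread K (pos a') (pos b') (pos c').
Hypothesis eq_sum : (pos a + pos b + pos c = pos a' + pos b' + pos c')%N.
Let t1 := [set a; b; c].
Let t2 := [set a'; b'; c'].

Lemma no_taco : t1 != t2 -> ~~ forms Taco t1 t2.
Proof.
apply: contraNN => /existsP[u /existsP[v /existsP[x /existsP[y]]]].
move=> /and5P[uv /eqP e _ _ _].
have /setIP[u1 u2] : u \in t1 :&: t2 by rewrite e set21.
have /setIP[v1 v2] : v \in t1 :&: t2 by rewrite e set22.
rewrite mem3_pos in u1; rewrite mem3_pos in u2.
rewrite mem3_pos in v1; rewrite mem3_pos in v2; rewrite -(inj_eq pos_inj) in uv.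
have [/eqP ea /eqP eb /eqP ec] := spread_common2 spt spt' eq_sum uv u1 u2 v1 v2.
by move: ea eb ec; rewrite !(inj_eq pos_inj) /t1 /t2 => /eqP-> /eqP-> /eqP->.
Qed.

(** Of all the turns in [ccw], those at [v] between successive vertices are kept: they already fix
    the cyclic order of the five points. *)
Lemma share_vertexP words : share_vertex words t1 t2 ->
  exists v x1 x2 x3 x4, [/\ v \in t1, v \in t2,
    labels t1 [:: x1; x2; x3; x4] \in words,
    {in [:: x1; x2; x3; x4], forall x, x \notin t1 -> x \in t2}
  & [&& cyclic_lt (pos v) (pos x1) (pos x2), cyclic_lt (pos v) (pos x2) (pos x3)
      & cyclic_lt (pos v) (pos x3) (pos x4)]].
Proof.
move=> /existsP[v /existsP[[[|x1 [|x2 [|x3 [|x4 [|//]]]]] //= sz]]].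
move=> /and4P[/eqP ev /eqP es h lab].
have /setIP[v1 v2] : v \in t1 :&: t2 by rewrite ev set11.
exists v, x1, x2, x3, x4; split=> //.
  move=> x xs /negPf xt1; have : x \in (t1 :|: t2) :\ v by rewrite -es inE.
  by rewrite !in_setD1 in_setU xt1 => /andP[].
move: h; rewrite !areaE.
by move=> /andP[/andP[/andP[-> _] /andP[/andP[-> _] /andP[/andP[-> _] _]]] _].
Qed.

Lemma no_bat : ~~ forms Bat t1 t2.
Proof.
apply/negP => /share_vertexP[v [x1 [x2 [x3 [x4 [v1 v2 lab t12 h]]]]]].
have m1 := t12 x1; have m2 := t12 x2; have m3 := t12 x3; have m4 := t12 x4.
rewrite !mem3_pos !inE !eqxx ?orbT in v1 v2 m1 m2 m3 m4.
move: lab; rewrite /labels /= !in_cons in_nil !eqseq_cons !eqbF_neg.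
rewrite !eqb_id !andbT !orbF !mem3_pos.
(* The two words are complementary; the second is treated by exchanging the triangles. *)
move=> /orP[] /and4P[h1 h2 h3 h4]; move: h; apply/negP.
  exact: (spread_not_bat spt spt' v1 v2 h1 h2 (m3 isT h3) (m4 isT h4)).
exact: (spread_not_bat spt' spt v2 v1 (m1 isT h1) (m2 isT h2) h3 h4).
Qed.

Lemma no_crossing : ~~ forms Crossing t1 t2.
Proof.
apply/negP => /share_vertexP[v [x1 [x2 [x3 [x4 [v1 v2 lab t12 h]]]]]].
have m1 := t12 x1; have m2 := t12 x2; have m3 := t12 x3; have m4 := t12 x4.
rewrite !mem3_pos !inE !eqxx ?orbT in v1 v2 m1 m2 m3 m4.
move: lab; rewrite /labels /= !in_cons in_nil !eqseq_cons !eqbF_neg.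
rewrite !eqb_id !andbT !orbF !mem3_pos.
move=> /orP[] /and4P[h1 h2 h3 h4]; move: h; apply/negP.
  exact: (spread_not_crossing spt spt' eq_sum v1 v2
    h1 (m2 isT h2) h3 (m4 isT h4)).
exact: (spread_not_crossing spt' spt (esym eq_sum) v2 v1
  (m1 isT h1) h2 (m3 isT h3) h4).
Qed.

Lemma no_ears : ~~ forms Ears t1 t2.
Proof.
apply/negP => /share_none_rot[//|r [ccwr lab [_ t2r]]].
case: r lab ccwr t2r => [|x1 [|x2 [|x3 [|y1 [|y2 [|y3 [|? ?]]]]]]] //=.
move=> [h1 h2 h3 h4 h5 h6] ccwr t2r.
move: ccwr; rewrite /= !areaE.
(* The digits in these names are ranks in the list of six points. *)
move=> /andP[/andP[/and5P[c123 c124 c125 c126 _] _]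
             /andP[/andP[/and4P[c234 c235 c236 _] _] _]].
move: (h1) (h2) (h3); rewrite !mem3_pos => m1 m2 m3.
apply/negP: (spread_not_ears spt spt' m1 m2 m3 c123).
suff cyc x : x \in t2 ->
    cyclic_lt (pos x1) (pos x2) (pos x) && cyclic_lt (pos x2) (pos x3) (pos x).
  by rewrite /= !cyc // !inE eqxx ?orbT.
move=> /t2r[]; rewrite !in_cons in_nil orbF.
by case/or4P=> [/eqP->|/eqP->|/eqP->|/or3P[] /eqP-> _];
   rewrite ?h1 ?h2 ?h3 ?c124 ?c125 ?c126 ?c234 ?c235 ?c236.
Qed.

Lemma no_david : ~~ forms David t1 t2.
Proof.
apply/negP => /share_none_rot[//|r [ccwr lab [rt2 _]]].
case: r lab ccwr rt2 => [|x1 [|y1 [|x2 [|y2 [|x3 [|y3 [|? ?]]]]]]] //=.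
move=> [h1 k1 h2 k2 h3 k3] ccwr rt2.
move: ccwr; rewrite /= !areaE.
move=> /andP[/andP[/and5P[c123 _ _ _ _]
         /andP[/and4P[_ c135 _ _] /andP[_ /andP[/andP[c156 _] _]]]]
       /andP[/andP[_ /andP[/and3P[_ c246 _] _]]
         /andP[/andP[/and3P[c345 _ _] _] _]]].
have [m1 m2 m3] : [/\ y1 \in t2, y2 \in t2 & y3 \in t2].
  by split; apply: rt2; rewrite ?k1 ?k2 ?k3 // !in_cons eqxx ?orbT.
rewrite !mem3_pos in h1 h2 h3 m1 m2 m3.
apply/negP: (spread_not_david spt spt' eq_sum h1 h2 h3 m1 m2 m3 c135 c246).
(* The gap from [x3] back to [x1] crosses the end of the list, so its turn is obtained by rotating
   [c156]. *)
by rewrite c123 c345 -areaE orient_rot areaE c156.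
Qed.

End LowerBound.

(** * Construction of the constant-sum family and final count *)

Lemma constant_sum_family (R : realType) (P : {fset 'rV[R]_2}) (K : nat) :
  convex_position P -> (4 * K <= #|{: P}|)%N ->
  exists2 F : {set {set P}}, (#|F| = K ^ 2)%N &
    [forall t in F, triangle t]
    && avoids [:: Taco; David; Crossing; Bat; Ears] F.
Proof.
move=> convP leKP; have [pos [pos_inj pos_onto areaE]] := ccw_enumeration convP.
(* For [K = 0] the set [P] may be empty, leaving no default point [x0]. *)
have [K0|K_gt0] := posnP K.
  exists set0; first by rewrite cards0 K0.
  by apply/andP; split; apply/forallP => t; rewrite inE.
have /card_gt0P[x0 _] : (0 < #|{: P}|)%N by lia.
pose p i := odflt x0 [pick x | pos x == i].
have posK i : (i < 4 * K)%N -> pos (p i) = i.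
  move=> ltiK; rewrite /p; case: pickP => [x /eqP //|none].
  by have [x /eqP] := pos_onto i (leq_trans ltiK leKP); rewrite none.
pose i1 (e : 'I_K * 'I_K) : nat := e.1.
pose i2 (e : 'I_K * 'I_K) : nat := (K + e.2)%N.
(* Since [e.1] and [e.2] are at most [K - 1], this runs between [2 * K] and [4 * K - 2]: the
   subtraction is never truncated and [4 * K] points suffice. *)
pose i3 (e : 'I_K * 'I_K) : nat := (4 * K - 2 - e.1 - e.2)%N.
have bounds e : [/\ (i1 e < K)%N, (K <= i2 e < 2 * K)%N,
    (2 * K <= i3 e < 4 * K)%N
    & (i1 e + i2 e + i3 e = 5 * K - 2)%N].
  by rewrite /i1 /i2 /i3; have := ltn_ord e.1; have := ltn_ord e.2; split; lia.
pose T e : {set P} := [set p (i1 e); p (i2 e); p (i3 e)].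
have posE e : [/\ pos (p (i1 e)) = i1 e, pos (p (i2 e)) = i2 e
    & pos (p (i3 e)) = i3 e].
  by have [? ? ? _] := bounds e; split; apply: posK; lia.
have spreadT e : spread K (pos (p (i1 e))) (pos (p (i2 e))) (pos (p (i3 e))).
  by have [-> -> ->] := posE e; rewrite /spread; case: (bounds e); lia.
have sumT e e' : (pos (p (i1 e)) + pos (p (i2 e)) + pos (p (i3 e))
    = pos (p (i1 e')) + pos (p (i2 e')) + pos (p (i3 e')))%N.
  have [-> -> ->] := posE e; have [-> -> ->] := posE e'.
  by case: (bounds e) => _ _ _ ->; case: (bounds e').
have T_inj : injective T.
  move=> e e' eT.
  have : p (i1 e) \in T e' by rewrite -eT !inE eqxx.
  have : p (i2 e) \in T e' by rewrite -eT !inE eqxx orbT.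
  rewrite !(mem3_pos pos_inj) /mem3; have [-> -> ->] := posE e'.
  have [-> -> _] := posE e; have [l1 l2 _ _] := bounds e.
  have [l1' l2' l3' _] := bounds e' => h2 h1.
  (* Disjointness of the arcs leaves one possible match for each of the first two vertices, and
     these determine the pair. *)
  have e1 : i1 e = i1 e' by lia.
  have e2 : i2 e = i2 e' by lia.
  case: e e' e1 e2 {eT h1 h2 l1 l2 l1' l2' l3'} => [i j] [i' j'].
  by rewrite /i1 /i2 /= => e1 /addnI e2; congr pair; apply: val_inj.
exists [set T e | e in setT].
  by rewrite card_imset // cardsT card_prod card_ord mulnn.
apply/andP; split.
  apply/forall_inP => _ /imsetP[e _ ->].
  rewrite /triangle /T -setUA cardsU1 cards2 !inE -!(inj_eq pos_inj).
  by have [-> -> ->] := posE e; case: (bounds e); lia.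
apply/forall_inP => _ /imsetP[e _ ->]; apply/forall_inP => _ /imsetP[e' _ ->].
apply/implyP => ne; rewrite /= andbT.
apply/and5P; split.
- exact: (no_taco pos_inj (spreadT e) (spreadT e') (sumT e e') ne).
- exact: (no_david pos_inj areaE (spreadT e) (spreadT e') (sumT e e')).
- exact: (no_crossing pos_inj areaE (spreadT e) (spreadT e') (sumT e e')).
- exact: (no_bat pos_inj areaE (spreadT e) (spreadT e')).
- exact: (no_ears pos_inj areaE (spreadT e) (spreadT e')).
Qed.

Theorem theorem17 (R : realType) :
  exists c C : R, [/\ 0 < c, 0 < C &
    exists N : nat, forall n : nat, (N <= n)%N ->
    forall P : {fset 'rV[R]_2}, #|` P|%fset = n -> convex_position P ->
      c * n%:R ^+ 2 <= (ex_size P [:: Taco; David; Crossing; Bat; Ears])%:R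
        <= C * n%:R ^+ 2].
Proof.
(* With [K = n %/ 4] and [n >= 4] one has [n <= 8 * K], so [K ^ 2] is at least [n ^ 2 / 64]. The
   constant 1 comes from the [n ^ 2] ordered pairs of points. *)
exists 64^-1, 1; split=> //; first by rewrite invr_gt0.
exists 4%N => n n4 P; rewrite cardfE => cardP convP; apply/andP; split.
  rewrite mulrC ler_pdivrMr // -natrX -natrM ler_nat.
  have [|F cardF Fok] := @constant_sum_family R P (n %/ 4) convP.
    by rewrite cardP mulnC leq_trunc_div.
  have : (#|F| <= ex_size P [:: Taco; David; Crossing; Bat; Ears])%N.
    exact: (bigop.leq_bigmax_cond F Fok).
  have : (n <= 8 * (n %/ 4))%N by lia.
  rewrite cardF -leq_sqr expnMn => /leq_trans h1 h2; apply: h1.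
  by rewrite mulnC leq_mul2r h2 orbT.
rewrite mul1r -natrX ler_nat /ex_size; apply/bigmax_leqP => F.
case/andP=> /forall_inP Ftri /forall_inP Fav.
rewrite -cardP; apply: taco_free_card => // t1 t2 t1F t2F ne.
by have /forall_inP/(_ _ t2F) := Fav _ t1F; rewrite ne /= => /andP[].
Qed.
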